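(* Let $\Lambda$ be a nonvoid subset of $\mathbb N$, $\Theta=\Lambda^{\mathbb N\setminus\{0\}}$ and $\mathcal X=\bigcup_{j\ge1}\Lambda^j$; for $\theta\in\Theta$ let $P_\theta=\sum_{j\ge1}2^{-j}\delta_{(\theta_1,\dots,\theta_j)}$ and let $s_\theta$ be its density with respect to the counting measure on $\mathcal X$. Let $\overline S=\{s_\theta:\theta\in\Theta\}$ and $S=\{s_\theta:\theta\in\pi_{-1}(\mathcal X)\}$. For all $s\in\overline S$ and $\overline s\in S$, $$D^S(\mathbf s,\overline{\mathbf s})\le4c_0^{-2}\big[2\sqrt2+n^2h^2(s,\overline s)\big]^2.$$
   Context: $n\ge3$. $\pi_{-1}:\mathcal X\to\Theta$ is a fixed map such that for every $x\in\Lambda^j$, $j\ge1$, the first $j$ entries of $\pi_{-1}(x)$ form $x$. $c_0=\frac18(1-\frac1{\sqrt2})$. $h^2(t,t')=\frac12\sum_{x\in\mathcal X}(\sqrt{t(x)}-\sqrt{t'(x)})^2$. A density $t$ is identified with $\mathbf t=(t,\dots,t)$ ($n$ copies). $\psi(u)=\frac{u-1}{\sqrt{1+u^2}}$ for $u\in[0,+\infty)$, $\psi(+\infty)=1$; conventions $0/0=1$, $x/0=+\infty$ for $x>0$, $\sup\varnothing=0$. $\mathbb E_{\mathbf s}$ is the expectation when $X_1,\dots,X_n$ are i.i.d. with density $s$ with respect to the counting measure. For $y\ge0$, $\mathcal B^S(\mathbf s,\overline{\mathbf s},y)=\{t\in S:nh^2(s,t)+nh^2(s,\overline s)\le y^2\}$,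 $\mathbf w^S(\mathbf s,\overline{\mathbf s},y)=\mathbb E_{\mathbf s}\big[\sup_{t\in\mathcal B^S(\mathbf s,\overline{\mathbf s},y)}\big|\sum_{i=1}^n\{\psi(\sqrt{t/\overline s}(X_i))-\mathbb E_{\mathbf s}[\psi(\sqrt{t/\overline s}(X_i))]\}\big|\big]$ ($0$ if the set is empty), and $D^S(\mathbf s,\overline{\mathbf s})=\overline y^2\vee1$ with $\overline y=\sup\{y\ge0:\mathbf w^S(\mathbf s,\overline{\mathbf s},y)>c_0y^2\}$. *)

(* Defs.v *)
From HB Require Import structures.
From mathcomp Require Import all_boot all_order all_algebra.
From mathcomp Require Import all_classical all_reals all_analysis.
From mathcomp Require Import finmap ring.

Set Implicit Arguments.
Unset Strict Implicit.
Unset Printing Implicit Defensive.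

Import Order.TTheory GRing.Theory Num.Theory.
Import numFieldNormedType.Exports.

Local Open Scope classical_set_scope.
Local Open Scope ring_scope.
Local Open Scope ereal_scope.

(* Observations live in [word] with the discrete sigma-algebra; the sample space
   (nonempty words over the alphabet Lam) is a subset of it. *)
Definition word := seq nat.

HB.instance Definition _ := Countable.copy word (seq nat).
HB.instance Definition _ := isPointed.Build word [::].
HB.instance Definition _ := @isMeasurable.Build default_measure_display
  word discrete_measurable discrete_measurable0
  discrete_measurableC discrete_measurableU.

(* A sequence (theta_1, theta_2, ...) is encoded from index 0: [theta j] stands
   for theta_(j+1), so that (theta_1, ..., theta_j) is [mkseq theta j]. *)
Definition Theta (Lam : set nat) : set (nat -> nat) :=
  [set theta | forall j, Lam (theta j)].

Definition sample_space (Lam : set nat) : set word :=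
  [set x | (1 <= size x)%N /\ forall a, a \in x -> Lam a].

Section densities.
Context (R : realType).

Definition has_counting_density (mu : set word -> \bar R) (s : word -> R) :=
  (forall x, (0 <= s x)%R) /\
  forall A : set word, mu A = \int[counting]_(x in A) (s x)%:E.

Definition Ptheta (theta : nat -> nat) : {measure set word -> \bar R} :=
  mseries (fun j => mscale (((2^-1 : R) ^+ j)%:nng)%R
                           (dirac (mkseq theta j : word))) 1.

(* The density with respect to the counting measure is the point mass; see
   [stheta_density]. *)
Definition stheta (theta : nat -> nat) (x : word) : R :=
  fine (Ptheta theta [set x]).

Lemma PthetaE theta A :
  Ptheta theta A = \sum_(1 <= j <oo) ((2^-1 : R) ^+ j)%:E * \d_(mkseq theta j : word) A.
Proof. by []. Qed.

Lemma Ptheta_fin theta A : Ptheta theta A \is a fin_num.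
Proof.
rewrite ge0_fin_numE//; apply: (@le_lt_trans _ _ 1); last exact: ltry.
have term_ge0 j : 0 <= ((2^-1 : R) ^+ j)%:E * \d_(mkseq theta j : word) A.
  by rewrite mule_ge0// lee_fin exprn_ge0.
rewrite PthetaE; apply: lime_le.
  by apply: is_cvg_nneseries => j _ _; exact: term_ge0.
apply: nearW => -[|k]; first by rewrite big_nil.
suff -> : 1 = (\sum_(1 <= j < k.+1) (2^-1 : R) ^+ j + 2^-1 ^+ k)%:E.
  rewrite EFinD -sumEFin -[leLHS]adde0; apply: leeD; last first.
    by rewrite lee_fin exprn_ge0.
  apply: lee_sum => j _; rewrite -[leRHS]mule1 lee_wpmul2l//.
  by rewrite diracE lee_fin; case: (_ \in _).
congr _%:E; elim: k => [|k IH]; first by rewrite big_nil add0r.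
by rewrite big_nat_recr//= [LHS]IH exprS; field.
Qed.

Lemma stheta_density theta : has_counting_density (Ptheta theta) (stheta theta).
Proof.
split=> [x|A]; first by rewrite fine_ge0.
pose c j : R := (if (1 <= j)%N then 2^-1 ^+ j else 0)%R.
have c_ge0 j : (0 <= c j)%R by rewrite /c; case: ifP => // _; exact: exprn_ge0.
have PE B : Ptheta theta B = \sum_(j <oo) (c j)%:E * \d_(mkseq theta j : word) B.
  rewrite PthetaE ereal_series eseries_mkcond.
  by apply: eq_eseriesr => j _; rewrite /c; case: ifP => //; rewrite mul0e.
under eq_integral do rewrite fineK ?Ptheta_fin// PE.
rewrite integral_nneseries//; last first.
  by move=> j x _; rewrite mule_ge0// lee_fin.
rewrite PE; apply: eq_eseriesr => j _.
rewrite ge0_integralZl//; last by rewrite lee_fin.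
congr (_ * _).
transitivity (\int[@counting word R]_(x in A)
    (\1_[set (mkseq theta j : word)] x)%:E).
  rewrite integral_indic//= diracE /counting; have [jA|jA] := boolP (_ \in A).
    rewrite (_ : _ `&` A = [set (mkseq theta j : word)]); last first.
      by apply/setIidPl => _ ->; exact: set_mem.
    by rewrite asboolT// fset_set1 cardfs1.
  rewrite (_ : _ `&` A = set0); last first.
    by rewrite -subset0 => _ [-> /mem_set]; exact/negP.
  by rewrite asboolT// fset_set0 cardfs0.
apply: eq_integral => x _; rewrite diracE indicE; congr (_%:R%:E).
by congr nat_of_bool; apply/idP/idP => /set_mem ->; exact/mem_set.
Qed.

Definition Sbar (Lam : set nat) : set (word -> R) :=
  [set stheta theta | theta in Theta Lam].

Definition model (Lam : set nat) (pi_1 : word -> nat -> nat) :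
    set (word -> R) :=
  [set stheta theta | theta in pi_1 @` sample_space Lam].

Definition hellinger2 (Lam : set nat) (t t' : word -> R) : \bar R :=
  (2^-1)%:E * \esum_(x in sample_space Lam)
                ((Num.sqrt (t x) - Num.sqrt (t' x)) ^+ 2)%:E.

Definition c0 : R := (8^-1 * (1 - (Num.sqrt 2)^-1))%R.

(* Only applied to u >= 0, so the value at -oo is irrelevant. *)
Definition psi (u : \bar R) : R :=
  match u with
  | r%:E => ((r - 1) / Num.sqrt (1 + r ^+ 2))%R
  | +oo => 1%R
  | -oo => 0%R
  end.

(* Conventions for densities: 0/0 = 1, and x/0 = +oo for x > 0. *)
Definition ratio (x y : R) : \bar R :=
  if y == 0%R then (if x == 0%R then 1 else +oo) else (x / y)%:E.

(* Supremum of a set of nonnegative extended reals, with sup of set0 = 0. *)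
Definition sup0 (A : set (\bar R)) : \bar R :=
  if `[< A = set0 >] then 0 else ereal_sup A.

Definition ball_rho n (Lam : set nat) (S : set (word -> R)) (s sbar : word -> R)
    (y : R) : set (word -> R) :=
  [set t | S t /\ n%:R%:E * hellinger2 Lam s t + n%:R%:E * hellinger2 Lam s sbar
                  <= (y ^+ 2)%:E].

(* The expectation under n i.i.d. observations of density s is taken on an
   arbitrary probability space (T, P) carrying such a sample X. *)
Section sample.
Context d (T : measurableType d) (P : probability T R) (n : nat).
Variable X : 'I_n -> {RV P >-> word}.

(* Some of the sets [A i] may be the whole space, so the product rule covers all
   subfamilies. *)
Definition iid_with_density (s : word -> R) :=
  (forall i, has_counting_density (distribution P (X i)) s) /\
  forall A : 'I_n -> set word,
    P (\bigcap_i (X i @^-1` A i)) = \prod_(i < n) P (X i @^-1` A i).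

Definition psi_ratio (t sbar : word -> R) (x : word) : R :=
  psi (sqrte (ratio (t x) (sbar x))).

Definition centered_sum (t sbar : word -> R) (w : T) : \bar R :=
  \sum_(i < n) ((psi_ratio t sbar (X i w))%:E -
                'E_P[fun w' => psi_ratio t sbar (X i w')]).

Definition wS (Lam : set nat) (S : set (word -> R)) (s sbar : word -> R)
    (y : R) : \bar R :=
  \int[P]_w sup0 [set `|centered_sum t sbar w| | t in ball_rho n Lam S s sbar y].

Definition DS (Lam : set nat) (S : set (word -> R)) (s sbar : word -> R)
    : \bar R :=
  let ybar := sup0 [set y%:E | y in
    [set y : R | (0 <= y)%R /\ (c0 * y ^+ 2)%:E < wS Lam S s sbar y]] in
  maxe (ybar ^+ 2) 1.

End sample.

End densities.
Arguments Ptheta R theta : clear implicits.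
Arguments stheta R theta x : clear implicits.
Arguments Sbar R Lam : clear implicits.
Arguments model R Lam pi_1 : clear implicits.
Arguments c0 R : clear implicits.

(* Main.v *)
(** For the density s of the sequence theta and a density t of another sequence
    sharing exactly its first k entries with theta, psi(sqrt(t / sbar)) is the
    difference of the indicators of the prefixes of t and of sbar, and on the
    support of s the complement of the prefixes of t is the set A_k of the
    prefixes of theta longer than k, of probability 2^-k <= h^2(s, t).  So, up to
    a null set, the supremum over the ball is at most the deviation attached to
    sbar plus the sum over all k with n 2^-k <= y^2 of
    |sum_i (1_(A_k)(X_i) - 2^-k)|, whose expectation is at most sqrt(n 2^-k) by
    pairwise independence.  A geometric series gives w(y) <= (3 + sqrt 2) y
    <= 4 sqrt 2 y, hence ybar <= 4 sqrt 2 / c0, which is the claimed bound even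
    without the term n^2 h^2(s, sbar). *)

Require Import Defs.
From HB Require Import structures.
From mathcomp Require Import all_boot all_order all_algebra.
From mathcomp Require Import all_classical all_reals all_analysis.
From mathcomp Require Import measurable_realfun ring lra.

Set Implicit Arguments.
Unset Strict Implicit.
Unset Printing Implicit Defensive.

Import Order.TTheory GRing.Theory Num.Theory.
Import numFieldNormedType.Exports.

Local Open Scope classical_set_scope.
Local Open Scope ring_scope.
Local Open Scope ereal_scope.

(** For [k = 0] this is the support of [Ptheta R theta]; larger [k] cuts off the prefixes of length
    at most [k]. *)
Definition prefixes_beyond (theta : nat -> nat) (k : nat) : set word :=
  [set x | (k < size x)%N /\ x = mkseq theta (size x)].

(** * Supports of the densities, their masses and Hellinger distances *)

Section prefix_tree.
Context (R : realType).
Implicit Types (theta : nat -> nat) (k : nat).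

Lemma mkseq_prefixes_beyond theta k j :
  ((mkseq theta j : word) \in prefixes_beyond theta k) = (k < j)%N.
Proof.
by apply/idP/idP => [/set_mem[]|kj]; [|apply/mem_set; split];
  rewrite ?size_mkseq.
Qed.

Lemma sum_half_tail k :
  \sum_(k.+1 <= j <oo) ((2^-1 : R) ^+ j)%:E = ((2^-1 : R) ^+ k)%:E.
Proof.
rewrite -nneseries_addn; last by move=> i; rewrite lee_fin exprn_ge0.
have := @cvg_geometric_eseries_half R 1 k; rewrite div1r -exprVn.
move/cvg_lim => <- //; congr (limn _).
apply/funext => m; apply: eq_bigr => i _.
by rewrite div1r natrX exprVn.
Qed.

Lemma Ptheta_prefixes_beyond theta k :
  Ptheta R theta (prefixes_beyond theta k) = ((2^-1 : R) ^+ k)%:E.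
Proof.
rewrite PthetaE -sum_half_tail [RHS]eseries_cond.
rewrite [RHS](@eq_eseriesl R _ (fun j => (k < j) && (1 <= j))%N); last first.
  by move=> [|j]; rewrite /= ?andbT ?andbF.
rewrite -eseries_cond [RHS]eseries_mkcond.
apply: eq_eseriesr => j _; rewrite diracE mkseq_prefixes_beyond.
by case: ifP => _; rewrite ?mule1 ?mule0.
Qed.

(** The series has one atom for each length, so only the term [j = size x] can charge [x]. *)
Lemma sthetaE theta (x : word) : stheta R theta x =
  ((2^-1 ^+ size x) * \1_(prefixes_beyond theta 0) x)%R.
Proof.
rewrite /stheta PthetaE eseries_cond indicE.
have term_ge0 j : 0 <= ((2^-1 : R) ^+ j)%:E * \d_(mkseq theta j : word) [set x].
  by rewrite mule_ge0// lee_fin exprn_ge0.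
case: (boolP (x \in _)) => [/set_mem [x_gt0 xE]|xN].
  rewrite (nneseriesD1 (n := size x)) //.
  rewrite eseries0 => [|j _ /andP[_ jx]].
    by rewrite adde0 diracE -xE mem_set.
  rewrite diracE memNset ?mule0// => /(congr1 size); rewrite size_mkseq.
  exact/eqP.
rewrite eseries0 ?mulr0// => j _ j_gt0.
rewrite diracE memNset ?mule0// => xE; move/negP: xN; apply; apply/mem_set.
by rewrite -xE; split; rewrite size_mkseq.
Qed.

(** Both densities equal [2^-|x|] on their supports, so the ratio is 1 (also as 0/0), 0 or [+oo],
    where [psi] of the root takes the values 0, -1 and 1. *)
Lemma psi_ratioE (t b : nat -> nat) (x : word) :
  psi_ratio (stheta R t) (stheta R b) x =
  (\1_(prefixes_beyond t 0) x - \1_(prefixes_beyond b 0) x)%R.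
Proof.
rewrite /psi_ratio /Defs.ratio !sthetaE !indicE.
have hx : ((2^-1 : R) ^+ size x != 0)%R by rewrite expf_neq0 ?invr_eq0.
case: (x \in _); case: (x \in _); rewrite ?mulr1 ?mulr0 ?(negbTE hx) ?eqxx /=.
- by rewrite divff//= sqrtr1 subrr mul0r.
- by rewrite mul0r sqrtr0 expr0n addr0 sqrtr1 divr1.
- by rewrite subr0.
- by rewrite sqrtr1 !subrr mul0r.
Qed.

(** Indices start at 0: prefixes of length at most [k] are common to both sequences, and longer ones
    contain the entry of index [k], which tells them apart. *)
Lemma prefixes_beyond_diff (t b : nat -> nat) k :
  (forall j, (j < k)%N -> t j = b j) -> t k != b k ->
  prefixes_beyond t 0 `\` prefixes_beyond b 0 = prefixes_beyond t k.
Proof.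
move=> tb tbk; apply/seteqP; split=> x /=.
  move=> [[x0 xt] xb]; split => //; rewrite ltnNge; apply/negP => xk; apply: xb.
  split => //; rewrite [LHS]xt; apply: (@eq_from_nth _ 0%N); rewrite !size_mkseq//.
  by move=> i ix; rewrite !nth_mkseq// tb// (leq_trans ix).
move=> [kx xt]; split; first by split=> //; exact: leq_ltn_trans kx.
move=> [_ xb]; move/eqP: tbk; apply.
by have /(congr1 (fun y => nth 0%N y k)) := etrans (esym xt) xb; rewrite !nth_mkseq.
Qed.

Lemma prefixes_beyond_image theta k :
  prefixes_beyond theta k = [set (mkseq theta j : word) | j in [set j | (k < j)%N]].
Proof.
apply/seteqP; split=> [x [kx xE]|_ [j kj <-]]; first by exists (size x).
by apply/set_mem; rewrite mkseq_prefixes_beyond.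
Qed.

(** There is exactly one word of each length greater than [k], which leaves a geometric tail. *)
Lemma esum_prefixes_beyond theta k :
  \esum_(x in prefixes_beyond theta k) ((2^-1 : R) ^+ size x)%:E =
  ((2^-1 : R) ^+ k)%:E.
Proof.
rewrite prefixes_beyond_image esum_set_image; first last.
- by move=> i j _ _ /(congr1 size); rewrite !size_mkseq.
- by move=> j _; rewrite lee_fin exprn_ge0.
rewrite -sum_half_tail [RHS]eseries_cond.
rewrite (@eq_eseriesl R _ (fun j => (k < j)%N)); last first.
  by move=> j; apply/idP/idP => [/set_mem|kj]//; exact/mem_set.
by apply: eq_eseriesr => j _; rewrite size_mkseq.
Qed.

Lemma prefixes_beyond_sample_space (Lam : set nat) theta k :
  Theta Lam theta -> prefixes_beyond theta k `<=` sample_space Lam.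
Proof.
move=> theta_Lam x [kx xE]; split; first exact: leq_ltn_trans kx.
by move=> a; rewrite xE => /mapP[j _ ->]; exact: theta_Lam.
Qed.

(** On each of the disjoint sets [prefixes_beyond t k] and [prefixes_beyond b k] one density
    vanishes, so each contributes [2^-k] to the sum of squares; the factor 1/2 is absorbed by having
    two of them. *)
Lemma hellinger2_ge (Lam : set nat) (t b : nat -> nat) k :
  Theta Lam t -> Theta Lam b ->
  (forall j, (j < k)%N -> t j = b j) -> t k != b k ->
  ((2^-1 : R) ^+ k)%:E <= hellinger2 Lam (stheta R t) (stheta R b).
Proof.
move=> tLam bLam tb tbk.
have At := prefixes_beyond_diff tb tbk.
have Ab : prefixes_beyond b 0 `\` prefixes_beyond t 0 = prefixes_beyond b k.
  by apply: prefixes_beyond_diff; [move=> j /tb|rewrite eq_sym].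
have f_ge0 x : 0 <= ((Num.sqrt (stheta R t x) - Num.sqrt (stheta R b x)) ^+ 2)%:E.
  by rewrite lee_fin sqr_ge0.
rewrite /hellinger2 lee_pdivlMl// -EFinM mulr2n mulrDl mul1r EFinD.
rewrite (esumID (prefixes_beyond t k))//; apply: leeD.
  rewrite setIidr; last exact: prefixes_beyond_sample_space.
  rewrite -(esum_prefixes_beyond t); apply: le_esum => x; rewrite -At.
  move=> -[xt xb]; rewrite !sthetaE !indicE mem_set// memNset//.
  by rewrite mulr0 sqrtr0 subr0 mulr1 sqr_sqrtr ?exprn_ge0.
rewrite (esumID (prefixes_beyond b k))// -[leLHS]adde0.
apply: leeD; last exact: esum_ge0.
rewrite setIidr; last first.
  move=> x xbk; split; first exact: (@prefixes_beyond_sample_space Lam b k).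
  by move: xbk; rewrite -Ab -At => -[xb xNt] [xt _].
rewrite -(esum_prefixes_beyond b); apply: le_esum => x; rewrite -Ab.
move=> -[xb xt]; rewrite !sthetaE !indicE memNset// mem_set//.
by rewrite mulr0 sqrtr0 sub0r mulr1 sqrrN sqr_sqrtr ?exprn_ge0.
Qed.

End prefix_tree.

(** * Mean absolute deviation of a sum of pairwise independent indicators *)

Section deviation.
Context d (T : measurableType d) (R : realType) (P : probability T R).

(* Needed because a supremum of measurable functions need not be measurable. *)
Lemma ge0_le_integral_nonmeasurable (f g : T -> \bar R) :
  (forall w, 0 <= f w) -> (forall w, f w <= g w) ->
  \int[P]_w f w <= \int[P]_w g w.
Proof.
move=> f0 fg; have g0 w : 0 <= g w by exact: le_trans (fg w).
rewrite !ge0_integralTE//; apply: le_ereal_sup => _ [h hf <-].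
by exists h => // w; exact: le_trans (fg w).
Qed.

(** The variance of the count [N] is at most its mean [q = n p]. Cauchy-Schwarz is replaced by the
    pointwise inequality [2 a Z <= Z^2 + a^2] with [a = sqrt q], which is then integrated. *)
Lemma integral_abs_deviation_le n (B : 'I_n -> set T) (p : R) :
  (forall i, measurable (B i)) -> (forall i, P (B i) = p%:E) ->
  (forall i j, i != j -> P (B i `&` B j) = (p * p)%:E) ->
  \int[P]_w (`|\sum_(i < n) (\1_(B i) w - p)|%R)%:E <= (Num.sqrt (n%:R * p))%:E.
Proof.
move=> mB PB PBB.
pose N w : R := (\sum_(i < n) \1_(B i) w)%R.
pose Z w : R := `|\sum_(i < n) (\1_(B i) w - p)|%R.
pose q : R := (n%:R * p)%R; pose a := Num.sqrt q.
have ZE w : Z w = `|N w - q|%R.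
  by rewrite /Z sumrB sumr_const card_ord -mulr_natl.
have N_ge0 w : (0 <= N w)%R by apply: sumr_ge0.
have mN : measurable_fun setT N.
  by apply: measurable_sum => i; exact: measurable_indic.
have mZ : measurable_fun setT Z.
  rewrite (_ : Z = (fun w => `|N w - q|%R)); last exact/funext.
  by apply: measurableT_comp => //; exact: measurable_funB.
have NE : \int[P]_w (N w)%:E = q%:E.
  under eq_integral do rewrite -sumEFin.
  rewrite ge0_integral_sum//; last first.
    by move=> i; apply/measurable_EFinP; exact: measurable_indic.
  rewrite (eq_bigr (fun=> p%:E)); last first.
    by move=> i _; rewrite integral_indic// setIT; exact: PB.
  by rewrite sumEFin sumr_const card_ord -mulr_natl.
have q_ge0 : (0 <= q)%R.
  by rewrite -lee_fin -NE; apply: integral_ge0 => w _; rewrite lee_fin.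
(* The final division by [a] excludes [q = 0]; in that case [Z = N], whose integral is 0. *)
have [q0|q_neq0] := eqVneq q 0%R.
  rewrite -/q q0 sqrtr0 -[X in _ <= X%:E]q0 -NE.
  apply: ge0_le_integral_nonmeasurable => w; rewrite lee_fin//.
  by rewrite -/(Z w) ZE q0 subr0 ger0_norm.
have q_gt0 : (0 < q)%R by rewrite lt_neqAle eq_sym q_neq0.
have a_gt0 : (0 < a)%R by rewrite sqrtr_gt0.
have aa : (a ^+ 2 = q)%R by rewrite sqr_sqrtr// ltW.
have NNE : \int[P]_w (N w ^+ 2)%:E <= (q + q ^+ 2)%:E.
  have -> : (fun w => (N w ^+ 2)%:E) =
      (fun w => \sum_(i < n) \sum_(j < n) (\1_(B i `&` B j) w)%:E).
    apply/funext => w; under eq_bigr do rewrite sumEFin.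
    rewrite sumEFin expr2 mulr_suml; congr (_%:E); apply: eq_bigr => i _.
    by rewrite mulr_sumr; apply: eq_bigr => j _; rewrite indicI.
  have mBI i j : measurable (B i `&` B j) by exact: measurableI.
  have mBB i j : measurable_fun setT (fun w => (\1_(B i `&` B j) w : R)%:E).
    by apply/measurable_EFinP; exact: measurable_indic.
  rewrite ge0_integral_sum//; first last.
  - by move=> i w _; apply: sume_ge0 => j _; rewrite lee_fin.
  - by move=> i; apply: emeasurable_sum.
  have -> : (q + q ^+ 2)%:E = \sum_(i < n) (p + n%:R * p ^+ 2)%:E :> \bar R.
    by rewrite sumEFin sumr_const card_ord -mulr_natl /q; congr _%:E; ring.
  (* In row [i] the diagonal term gives [p] and every other term [p^2]; the bound [n p^2] for the
     latter counts one extra [p^2]. *)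
  apply: lee_sum => i _; rewrite ge0_integral_sum//.
  rewrite (bigD1 i)//= EFinD; apply: leeD.
    by rewrite integral_indic// setIT setIid le_eqVlt -(PB i) eqxx.
  have -> : (n%:R * p ^+ 2)%:E = \sum_(j < n) (p * p)%:E :> \bar R.
    by rewrite sumEFin sumr_const card_ord -[in RHS]mulr_natl.
  rewrite [leRHS](bigD1 i)//= -[leLHS]add0e; apply: leeD.
    by rewrite lee_fin -expr2 sqr_ge0.
  apply: lee_sum => j ji.
  by rewrite integral_indic// setIT le_eqVlt -(PBB i j) ?eqxx// eq_sym.
have Z_ge0 w : (0 <= Z w)%R by exact: normr_ge0.
(* The cross term [2 q N] of the expanded square stands on the left so that both integrands are
   nonnegative and their integrals split. *)
have : \int[P]_w ((2 * a)%:E * (Z w)%:E + (2 * q)%:E * (N w)%:E) <=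
       \int[P]_w ((N w ^+ 2)%:E + (q ^+ 2 + a ^+ 2)%:E).
  apply: ge0_le_integral_nonmeasurable => w.
    rewrite -!EFinM -EFinD lee_fin; apply: addr_ge0; apply: mulr_ge0 => //;
      by apply: mulr_ge0 => //; exact: ltW.
  (* AM-GM: [2 a Z <= Z^2 + a^2] *)
  rewrite -!EFinM -!EFinD lee_fin -subr_ge0 [leRHS](_ : _ = (Z w - a) ^+ 2)%R ?sqr_ge0//.
  have -> : (N w ^+ 2 = (N w - q) ^+ 2 + 2 * q * N w - q ^+ 2)%R by ring.
  by rewrite -(real_normK (num_real (N w - q))) -ZE; ring.
rewrite ge0_integralD//; first last.
- by apply: emeasurable_funM => //; exact/measurable_EFinP.
- by move=> w _; rewrite -EFinM lee_fin mulr_ge0// ltW// mulr_gt0.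
- by apply: emeasurable_funM => //; exact/measurable_EFinP.
- by move=> w _; rewrite -EFinM lee_fin mulr_ge0// ltW// mulr_gt0.
rewrite [in X in _ <= X -> _]ge0_integralD//; first last.
- by move=> w _; rewrite lee_fin addr_ge0// sqr_ge0.
- by apply/measurable_EFinP; exact: measurable_funX.
- by move=> w _; rewrite lee_fin sqr_ge0.
rewrite integral_cst//= probability_setT mule1.
rewrite !ge0_integralZl_EFin//; first last.
- by rewrite mulr_ge0// ltW.
- exact/measurable_EFinP.
- by move=> w _; rewrite lee_fin.
- by rewrite mulr_ge0// ltW.
- exact/measurable_EFinP.
- by move=> w _; rewrite lee_fin.
rewrite NE => /le_trans /(_ (leeD NNE (lexx _))).
have : 0 <= \int[P]_w (Z w)%:E by apply: integral_ge0 => w _; rewrite lee_fin.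
(* What remains is [2 a E[Z] + 2 q^2 <= 2 q + 2 q^2] with [q = a^2]; the finite right side rules out
   an infinite integral. *)
rewrite -/Z -/a; case: (\int[P]_w (Z w)%:E) => [z z_ge0|_|//].
  rewrite -!EFinM -!EFinD !lee_fin aa => zle.
  by rewrite -(ler_pM2l a_gt0) -expr2 aa; lra.
by rewrite gt0_muley ?lte_fin ?mulr_gt0.
Qed.

End deviation.

(** * Deviations of prefix events in an i.i.d. sample *)

Section prefix_deviation.
Context (R : realType) (n : nat) (theta : nat -> nat).
Context d (T : measurableType d) (P : probability T R).
Variable X : 'I_n -> {RV P >-> word}.
Hypothesis X_iid : iid_with_density X (stheta R theta).

(** Complements of supports are used because their probability under [Ptheta R theta] is small when
    [t] is close to [theta]. *)
Definition avoids (t : nat -> nat) : set word := ~` prefixes_beyond t 0.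

(** Every atom of [Ptheta R theta] is a nonempty prefix of [theta], so only the trace of an event on
    these prefixes counts. *)
Lemma eq_Ptheta (A B : set word) :
  prefixes_beyond theta 0 `&` A = prefixes_beyond theta 0 `&` B ->
  Ptheta R theta A = Ptheta R theta B.
Proof.
move=> AB; rewrite !PthetaE eseries_cond [RHS]eseries_cond.
apply: eq_eseriesr => j /= j_gt0; congr (_ * _); rewrite !diracE.
have := mkseq_prefixes_beyond theta 0 j; rewrite j_gt0 => /set_mem thj.
have /seteqP[AB1 AB2] := AB.
congr (nat_of_bool _)%:R%:E; apply/idP/idP => /set_mem h; apply/mem_set.
- by have [] := AB1 _ (conj thj h).
- by have [] := AB2 _ (conj thj h).
Qed.

Lemma Ptheta_avoids_self : Ptheta R theta (avoids theta) = 0.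
Proof.
rewrite (@eq_Ptheta _ set0) ?measure0// setI0.
by rewrite /avoids setICr.
Qed.

Lemma Ptheta_avoids (t : nat -> nat) k :
  (forall j, (j < k)%N -> theta j = t j) -> theta k != t k ->
  Ptheta R theta (avoids t) = ((2^-1 : R) ^+ k)%:E.
Proof.
move=> tht thtk; rewrite -(Ptheta_prefixes_beyond R theta k).
apply: eq_Ptheta; rewrite -setDE (prefixes_beyond_diff tht thtk).
by rewrite setIidr// => x [kx xE]; split=> //; exact: leq_ltn_trans kx.
Qed.

Lemma first_difference (t u : nat -> nat) :
  t = u \/ exists2 k, (forall j, (j < k)%N -> t j = u j) & t k != u k.
Proof.
have [/funext|/existsNP[j /eqP tj]] := pselect (forall j, t j = u j); first by left.
right; have ex : exists k, t k != u k by exists j.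
case: (ex_minnP ex) => k tk kmin; exists k => // i ik; apply/eqP/negPn/negP.
by move=> /kmin; rewrite leqNgt ik.
Qed.

(** Applied to the sequence of [sbar], this lets the radius of the ball control the deviation
    attached to [sbar]. *)
Lemma Ptheta_avoids_le_hellinger2 (Lam : set nat) (t : nat -> nat) :
  Theta Lam theta -> Theta Lam t ->
  Ptheta R theta (avoids t) <= hellinger2 Lam (stheta R theta) (stheta R t).
Proof.
move=> thL tL; have [<-|[k tht thtk]] := first_difference theta t.
  rewrite Ptheta_avoids_self mule_ge0//; apply: esum_ge0 => x _.
  by rewrite lee_fin sqr_ge0.
by rewrite (Ptheta_avoids tht thtk); exact: hellinger2_ge.
Qed.

Lemma measurable_preimage_word i (A : set word) : measurable (X i @^-1` A).
Proof. by rewrite -[X in measurable X]setTI; exact: measurable_funP. Qed.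

Lemma P_preimage_word i (A : set word) : P (X i @^-1` A) = Ptheta R theta A.
Proof.
by case: X_iid => /(_ i) [_ /(_ A)] + _; rewrite -(stheta_density R theta).2.
Qed.

Lemma P_preimage_word2 i j (A B : set word) : i != j ->
  P (X i @^-1` A `&` X j @^-1` B) = Ptheta R theta A * Ptheta R theta B.
Proof.
(* Pairwise independence comes from the full product rule with the whole space at every other
   index. *)
move=> ij; pose C l := if l == i then A else if l == j then B else setT.
have := X_iid.2 C; rewrite [X in P X](_ : _ = X i @^-1` A `&` X j @^-1` B).
  move=> ->; rewrite (bigD1 i)//= (bigD1 j) 1?eq_sym//=.
  rewrite big1 => [|l /andP[li lj]].
    by rewrite mule1 /C !eqxx eq_sym (negbTE ij) !P_preimage_word.
  by rewrite /C (negbTE li) (negbTE lj) preimage_setT probability_setT.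
apply/seteqP; split=> [w /= XC|w [/= XA XB] l _].
  have := XC i Logic.I; have := XC j Logic.I.
  by rewrite /C !eqxx eq_sym (negbTE ij).
by rewrite /C /=; case: eqP => [->//|_]; case: eqP => [->//|_].
Qed.

Definition deviation (A : set word) (w : T) : R :=
  \sum_(i < n) (\1_A (X i w) - fine (Ptheta R theta A)).

Lemma measurable_indic_word i (A : set word) :
  measurable_fun setT (fun w => \1_A (X i w) : R).
Proof.
rewrite (_ : (fun w => _) = \1_(X i @^-1` A)); last first.
  by apply/funext => w; rewrite !indicE.
by apply: measurable_indic; exact: measurable_preimage_word.
Qed.

Lemma measurable_deviation A : measurable_fun setT (deviation A).
Proof.
by apply: measurable_sum => i; apply: measurable_funB => //;
  exact: measurable_indic_word.
Qed.

Lemma integral_deviation_le A :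
  \int[P]_w `|deviation A w|%:E <= (Num.sqrt (n%:R * fine (Ptheta R theta A)))%:E.
Proof.
have := @integral_abs_deviation_le _ T R P n (fun i => X i @^-1` A)
  (fine (Ptheta R theta A)).
apply=> [i|i|i j ij]; first exact: measurable_preimage_word.
- by rewrite P_preimage_word fineK// Ptheta_fin.
- by rewrite P_preimage_word2// EFinM !fineK// Ptheta_fin.
Qed.

(* Almost surely zero; it makes the bounds below valid at every sample point. *)
Definition strays (w : T) : R := \sum_(i < n) \1_(avoids theta) (X i w).

Lemma strays_ge0 w : (0 <= strays w)%R. Proof. by apply: sumr_ge0. Qed.

Lemma measurable_strays : measurable_fun setT strays.
Proof. by apply: measurable_sum => i; exact: measurable_indic_word. Qed.

Lemma integral_strays : \int[P]_w (strays w)%:E = 0.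
Proof.
under eq_integral do rewrite -sumEFin.
rewrite ge0_integral_sum//; last first.
  by move=> i; apply/measurable_EFinP; exact: measurable_indic_word.
rewrite big1// => i _.
transitivity (\int[P]_w (\1_(X i @^-1` avoids theta) w)%:E).
  by apply: eq_integral => w _; rewrite !indicE.
rewrite integral_indic//; last exact: measurable_preimage_word.
by rewrite setIT; transitivity (Ptheta R theta (avoids theta));
  [exact: P_preimage_word|exact: Ptheta_avoids_self].
Qed.

Lemma deviation_avoids_self w : (`|deviation (avoids theta) w| <= strays w)%R.
Proof.
by rewrite /deviation Ptheta_avoids_self; under eq_bigr do rewrite subr0;
  rewrite ger0_norm// strays_ge0.
Qed.

(** Both events have probability [2^-k], so the centerings cancel; their indicators differ only at
    words outside the support of [theta], which [strays] counts. *)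
Lemma deviation_avoids (t : nat -> nat) k w :
  (forall j, (j < k)%N -> theta j = t j) -> theta k != t k ->
  (`|deviation (avoids t) w| <=
   `|deviation (prefixes_beyond theta k) w| + strays w)%R.
Proof.
move=> tht thtk; rewrite -lerBlDl; apply: le_trans (lerB_dist _ _) _.
rewrite /deviation (Ptheta_avoids tht thtk) Ptheta_prefixes_beyond -sumrB.
apply: le_trans (ler_norm_sum _ _ _) _; apply: ler_sum => i _.
rewrite opprB addrA subrK -(prefixes_beyond_diff tht thtk) /avoids !indicE.
rewrite in_setD !in_setC; case: (_ \in _); case: (_ \in _);
  by rewrite /= ?subrr ?subr0 ?sub0r ?normrN ?normr0 ?normr1.
Qed.

(** Passing to complements reverses the difference of indicators, hence the order of [b] and [t]. *)
Lemma expectation_psi_ratio (t b : nat -> nat) i :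
  'E_P[fun w => psi_ratio (stheta R t) (stheta R b) (X i w)] =
  (fine (Ptheta R theta (avoids b)) - fine (Ptheta R theta (avoids t)))%:E.
Proof.
have intA A : P.-integrable setT (fun w => (\1_A (X i w) : R)%:E).
  rewrite (_ : (fun w => _) = (fun w => (\1_(X i @^-1` A) w)%:E)); last first.
    by apply/funext => w; rewrite !indicE.
  by apply: integrable_indic => //; exact: measurable_preimage_word.
have EA A : \int[P]_w (\1_A (X i w) : R)%:E = Ptheta R theta A.
  transitivity (\int[P]_w (\1_(X i @^-1` A) w)%:E).
    by apply: eq_integral => w _; rewrite !indicE.
  rewrite integral_indic//; last exact: measurable_preimage_word.
  by rewrite setIT; exact: P_preimage_word.
rewrite unlock EFinB !fineK ?Ptheta_fin// -!EA -integralB//.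
apply: eq_integral => w _; rewrite psi_ratioE /avoids -EFinB !indicC !indicE.
by congr _%:E; case: (_ \in _); case: (_ \in _); rewrite /= ?subrr ?subr0 ?sub0r.
Qed.

Lemma centered_sumE (t b : nat -> nat) w :
  centered_sum X (stheta R t) (stheta R b) w =
  (deviation (avoids b) w - deviation (avoids t) w)%:E.
Proof.
rewrite /centered_sum /deviation -sumrB -sumEFin; apply: eq_bigr => i _.
rewrite expectation_psi_ratio -EFinB psi_ratioE /avoids !indicC !indicE.
by congr _%:E; case: (_ \in _); case: (_ \in _); rewrite /=; ring.
Qed.

End prefix_deviation.

(** * Linear bound on the modulus [wS] *)

Section modulus.
Context (R : realType) (n : nat) (theta : nat -> nat) (Lam : set nat).
Context d (T : measurableType d) (P : probability T R).
Variable X : 'I_n -> {RV P >-> word}.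
Hypothesis X_iid : iid_with_density X (stheta R theta).
Hypothesis theta_Lam : Theta Lam theta.

(** A lower bound for [n h^2] between [theta] and a sequence first differing from it at index
    [k]. *)
Let half_level k : R := (n%:R * 2^-1 ^+ k)%R.

Lemma hellinger2_ge0 (s t : word -> R) : 0 <= hellinger2 Lam s t.
Proof.
by rewrite mule_ge0//; apply: esum_ge0 => x _; rewrite lee_fin sqr_ge0.
Qed.

Lemma geometric_series_le (x : R) : (0 <= x < 1)%R ->
  \sum_(j <oo) (x ^+ j)%:E <= ((1 - x)^-1)%:E.
Proof.
move=> /andP[x_ge0 x_lt1]; have x1 : (0 < 1 - x)%R by rewrite subr_gt0.
apply: lime_le.
  by apply: is_cvg_nneseries => j _ _; rewrite lee_fin exprn_ge0.
apply: nearW => m; rewrite sumEFin lee_fin big_mkord -[leRHS]mul1r.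
rewrite ler_pdivlMr// mulrC -[X in (X * _)%R]opprB mulNr -subrX1 opprB.
by rewrite gerBl exprn_ge0.
Qed.

(** The deviation of [t] depends, up to [strays], only on the index of first difference. One
    countable sum over these indices therefore dominates the whole supremum, and it is
    measurable. *)
Definition deviation_from (k0 : nat) (w : T) : \bar R :=
  \sum_(j <oo) (`|deviation theta X (prefixes_beyond theta (k0 + j)) w|%R)%:E.

Lemma deviation_le_deviation_from k0 k w : (k0 <= k)%N ->
  (`|deviation theta X (prefixes_beyond theta k) w|%R)%:E <= deviation_from k0 w.
Proof.
move=> k0k; rewrite /deviation_from (nneseriesD1 (n := k - k0)%N)//.
by rewrite subnKC// leeDl// nneseries_ge0.
Qed.

(** The term of index [j] has mean at most [sqrt (n 2^-(k0 + j)) <= y r^j] with [r = 1 / sqrt 2],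
    and the geometric series is summed. *)
Lemma integral_deviation_from_le k0 (y : R) : (0 <= y)%R ->
  (half_level k0 <= y ^+ 2)%R ->
  \int[P]_w deviation_from k0 w <= (y * (1 - Num.sqrt 2^-1)^-1)%:E.
Proof.
move=> y_ge0 ky; rewrite integral_nneseries//; last first.
  move=> j; apply/measurable_EFinP; apply: measurableT_comp => //.
  exact: measurable_deviation.
set r : R := Num.sqrt 2^-1.
have r_lt1 : (r < 1)%R by rewrite -sqrtr1 ltr_sqrt//; lra.
rewrite EFinM; apply: (@le_trans _ _ (\sum_(j <oo) y%:E * (r ^+ j)%:E)).
  apply: lee_nneseries => [j _ _|j _]; first exact: integral_ge0.
  apply: le_trans (integral_deviation_le X_iid _) _.
  rewrite Ptheta_prefixes_beyond /= -EFinM lee_fin exprD mulrA.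
  rewrite sqrtrM; last by rewrite mulr_ge0// exprn_ge0.
  apply: ler_pM; rewrite ?sqrtr_ge0//; last first.
    have -> : (2^-1 ^+ j = (r ^+ j) ^+ 2)%R by rewrite exprAC sqr_sqrtr.
    by rewrite sqrtr_sqr ger0_norm// exprn_ge0// sqrtr_ge0.
  by rewrite -(ger0_norm y_ge0) -sqrtr_sqr ler_wsqrtr.
rewrite nneseriesZl; last by move=> j _; rewrite lee_fin exprn_ge0// sqrtr_ge0.
rewrite lee_wpmul2l ?lee_fin//; apply: geometric_series_le.
by rewrite sqrtr_ge0.
Qed.

Lemma centered_sum_le (t b : nat -> nat) k0 w :
  (forall k, (forall j, (j < k)%N -> theta j = t j) -> theta k != t k ->
    (k0 <= k)%N) ->
  `|centered_sum X (stheta R t) (stheta R b) w| <=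
    (`|deviation theta X (avoids b) w|%R)%:E +
      ((strays theta X w)%:E + deviation_from k0 w).
Proof.
move=> tk0; rewrite (centered_sumE X_iid) abse_EFin.
apply: (@le_trans _ _ (`|deviation theta X (avoids b) w|%:E +
  `|deviation theta X (avoids t) w|%:E)).
  by rewrite -EFinD lee_fin ler_normB.
apply: leeD => //; have [<-|[k tht thtk]] := first_difference theta t.
  rewrite -[leLHS]adde0; apply: leeD; last exact: nneseries_ge0.
  by rewrite lee_fin deviation_avoids_self.
apply: le_trans (leeD (lexx _) (deviation_le_deviation_from w (tk0 _ tht thtk))).
by rewrite -EFinD lee_fin addrC; exact: deviation_avoids.
Qed.

Lemma exists_half_level_le (y : R) : (0 < y)%R ->
  exists k, (half_level k <= y ^+ 2)%R.
Proof.
move=> y_gt0; have y2_gt0 : (0 < y ^+ 2)%R by rewrite exprn_gt0.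
(* The archimedean bound [m] of a real number satisfies [2^m] greater than that number. *)
exists (Num.bound (n%:R / y ^+ 2)%R).
have := upper_nthrootP (leqnn (Num.bound (n%:R / y ^+ 2)%R)).
rewrite /half_level exprVn ler_pdivrMr ?exprn_gt0// => /ltW.
by rewrite ler_pdivrMr// mulrC.
Qed.

Lemma wS_le (S : set (word -> R)) (b : nat -> nat) (y : R) :
  S `<=` Sbar R Lam -> Theta Lam b -> (0 < y)%R ->
  wS X Lam S (stheta R theta) (stheta R b) y <= (4 * Num.sqrt 2 * y)%:E.
Proof.
move=> S_Sbar b_Lam y_gt0; rewrite /wS; set B := ball_rho _ _ _ _ _ _.
have bound_ge0 : (0 <= 4 * Num.sqrt 2 * y)%R.
  by rewrite !mulr_ge0 ?sqrtr_ge0// ltW.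
(* Any member [t0] of the ball yields [n h^2(s, sbar) <= y^2], which later bounds the deviation
   attached to [sbar]. *)
have [/eqP/set0P[t0 [_ t0y]]|B0] := pselect (B <> set0); last first.
  rewrite (_ : B = set0); last exact: contrapT.
  rewrite integral0_eq ?lee_fin// => w _.
  by rewrite image_set0 /Defs.sup0; case: ifPn => // /asboolPn.
have ex_k0 := exists_half_level_le y_gt0.
(* By minimality of [k0], a density in the ball agrees with [theta] on at least the first [k0]
   entries. *)
case: (ex_minnP ex_k0) => k0 k0y k0_min.
pose G w := (`|deviation theta X (avoids b) w|%R)%:E +
  ((strays theta X w)%:E + deviation_from k0 w).
have dev_from_ge0 w : 0 <= deviation_from k0 w by exact: nneseries_ge0.
have strays_ge0' w : 0 <= (strays theta X w)%:E by rewrite lee_fin strays_ge0.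
have G_ge0 w : 0 <= G w by rewrite !adde_ge0.
have sup_le w : Defs.sup0 [set `|centered_sum X t (stheta R b) w| | t in B] <= G w.
  rewrite /Defs.sup0; case: ifPn => // _; apply: ge_ereal_sup => _ [t [St ty] <-].
  have [t' t'_Lam t'E] := S_Sbar _ St; rewrite -t'E in ty *.
  apply: centered_sum_le => k tht thtk; apply: k0_min; rewrite -lee_fin.
  apply: le_trans ty; rewrite -[leLHS]adde0; apply: leeD.
    by rewrite EFinM lee_wpmul2l// hellinger2_ge.
  by rewrite mule_ge0// hellinger2_ge0.
have sup_ge0 w : 0 <= Defs.sup0 [set `|centered_sum X t (stheta R b) w| | t in B].
  rewrite /Defs.sup0; case: ifPn => // /asboolPn/eqP/set0P[x Ax].
  apply: le_trans (ereal_sup_ubound Ax); case: Ax => t _ <-; exact: abse_ge0.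
apply: (@le_trans _ _ (\int[P]_w G w)).
  exact: ge0_le_integral_nonmeasurable.
have mdev A : measurable_fun setT (fun w => (`|deviation theta X A w|%R)%:E).
  apply/measurable_EFinP; apply: measurableT_comp => //.
  exact: measurable_deviation.
have mfrom : measurable_fun setT (deviation_from k0).
  have := @ge0_emeasurable_sum _ T R setT (fun j w =>
    (`|deviation theta X (prefixes_beyond theta (k0 + j)) w|%R)%:E) xpredT.
  by apply.
have mstrays : measurable_fun setT (fun w => (strays theta X w)%:E).
  by apply/measurable_EFinP; exact: measurable_strays.
rewrite /G ge0_integralD//; last exact: emeasurable_funD.
2: by move=> w _; rewrite adde_ge0.
rewrite ge0_integralD// (integral_strays X_iid) add0e.
have devb : \int[P]_w (`|deviation theta X (avoids b) w|%R)%:E <= y%:E.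
  apply: le_trans (integral_deviation_le X_iid _) _; rewrite lee_fin.
  rewrite -[leRHS](ger0_norm (ltW y_gt0)) -sqrtr_sqr ler_wsqrtr//.
  rewrite -lee_fin EFinM fineK ?Ptheta_fin//.
  apply: le_trans t0y; rewrite -[leLHS]add0e; apply: leeD.
    by rewrite mule_ge0// hellinger2_ge0.
  by rewrite lee_wpmul2l// Ptheta_avoids_le_hellinger2.
apply: le_trans (leeD devb (integral_deviation_from_le (ltW y_gt0) k0y)) _.
rewrite -EFinD lee_fin; set r : R := Num.sqrt 2^-1.
have r_ge0 : (0 <= r)%R by exact: sqrtr_ge0.
have rr : (r ^+ 2 = 2^-1)%R by rewrite sqr_sqrtr.
have r_lt1 : (r < 1)%R by rewrite -sqrtr1 ltr_sqrt//; lra.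
have -> : (Num.sqrt 2 = 2 * r)%R.
  rewrite -[RHS]ger0_norm ?mulr_ge0// -sqrtr_sqr exprMn rr.
  by congr Num.sqrt; lra.
have -> : ((1 - r)^-1 = 2 + 2 * r)%R.
  apply: (mulIf (x := 1 - r)%R); first by rewrite subr_eq0 gt_eqF.
  rewrite mulVf ?subr_eq0 ?gt_eqF//.
  have -> : ((2 + 2 * r) * (1 - r) = 2 - 2 * r ^+ 2)%R by ring.
  by rewrite rr; lra.
(* The remaining inequality [y (3 + 2 r) <= 8 r y] amounts to [r >= 1/2]. *)
have r_ge : (2^-1 <= r)%R.
  by rewrite -rr expr2 -[leRHS]mulr1 ler_wpM2l// ltW.
nra.
Qed.

End modulus.

(** * From the modulus to the bound on [DS] *)

Lemma c0_gt0 (R : realType) : (0 < c0 R)%R.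
Proof.
rewrite /c0 mulr_gt0// subr_gt0 invf_lt1 ?sqrtr_gt0//.
by rewrite -[ltLHS]sqrtr1 ltr_sqrt//; lra.
Qed.

(** It makes [4 sqrt 2 / c0] at least 1, which absorbs the 1 in the maximum defining [DS]. *)
Lemma c0_le (R : realType) : (c0 R <= 8^-1)%R.
Proof. by rewrite /c0 ler_piMr// gerBl invr_ge0 sqrtr_ge0. Qed.

Theorem proposition30 (R : realType) (n : nat) (n_ge3 : (3 <= n)%N)
  (Lam : set nat) (Lam_neq0 : Lam !=set0)
  (pi_1 : word -> nat -> nat)
  (pi_1_Theta : forall x, sample_space Lam x -> Theta Lam (pi_1 x))
  (pi_1_prefix : forall x, sample_space Lam x -> mkseq (pi_1 x) (size x) = x)
  (s : word -> R) (s_Sbar : Sbar R Lam s)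
  (sbar : word -> R) (sbar_S : model R Lam pi_1 sbar)
  (d : measure_display) (T : measurableType d) (P : probability T R)
  (X : 'I_n -> {RV P >-> word}) (X_iid : iid_with_density X s) :
  DS X Lam (model R Lam pi_1) s sbar <=
    (4 * c0 R ^- 2)%:E *
      ((2 * Num.sqrt 2)%:E + (n ^ 2)%:R%:E * hellinger2 Lam s sbar) ^+ 2.
Proof.
have [theta theta_Lam thetaE] := s_Sbar.
have S_Sbar : model R Lam pi_1 `<=` Sbar R Lam.
  by move=> t [u [x xL <-] <-]; exists (pi_1 x) => //; exact: pi_1_Theta.
have [b b_Lam bE] := S_Sbar _ sbar_S.
subst s sbar.
set h := hellinger2 _ _ _.
have h_ge0 : 0 <= h by exact: hellinger2_ge0.
have c0_pos := c0_gt0 R.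
(* Comparing [c0 y^2] with [4 sqrt 2 y] gives this threshold, and [M^2 = 4 c0^-2 (2 sqrt 2)^2]. *)
pose M : R := (4 * Num.sqrt 2 / c0 R)%R.
have M_ge0 : (0 <= M)%R by rewrite !mulr_ge0 ?sqrtr_ge0// invr_ge0 ltW.
apply: (@le_trans _ _ (M ^+ 2)%:E); last first.
  have -> : (M ^+ 2 = (4 * c0 R ^- 2) * (2 * Num.sqrt 2) ^+ 2)%R.
    by rewrite /M exprMn exprVn; ring.
  rewrite EFinM lee_wpmul2l//.
    by rewrite lee_fin mulr_ge0// invr_ge0 exprn_ge0// ltW.
  have s2_ge0 : 0 <= (2 * Num.sqrt 2 : R)%:E by rewrite lee_fin mulr_ge0 ?sqrtr_ge0.
  have nh_ge0 : 0 <= (n ^ 2)%:R%:E * h by rewrite mule_ge0// lee_fin.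
  by rewrite EFin_expe lee_sqr ?adde_ge0// leeDl.
rewrite /DS ge_max; apply/andP; split; last first.
  rewrite lee_fin exprn_ege1// ler_pdivlMr// mul1r.
  apply: le_trans (c0_le R) _.
  have : (1 <= Num.sqrt (2 : R))%R by rewrite -[leLHS]sqrtr1 ler_sqrt//; lra.
  lra.
set ybar := Defs.sup0 _.
have ybar_ge0 : 0 <= ybar.
  rewrite /ybar /Defs.sup0; case: ifPn => // /asboolPn/eqP/set0P[x Ax].
  by apply: le_trans (ereal_sup_ubound Ax); case: Ax => y [y_ge0 _] <-.
have ybar_le : ybar <= M%:E.
  rewrite /ybar /Defs.sup0; case: ifPn => [_|_]; first by rewrite lee_fin.
  apply: ge_ereal_sup => _ [y [y_ge0 wy] <-]; rewrite lee_fin.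
  (* The linear bound on [wS] is for [y > 0], where a factor [y] can be cancelled; [y = 0] is below
     [M] anyway. *)
  have [->//|y_neq0] := eqVneq y 0%R.
  have y_gt0 : (0 < y)%R by rewrite lt_neqAle eq_sym y_neq0.
  have := lt_le_trans wy (wS_le X_iid theta_Lam S_Sbar b_Lam y_gt0).
  rewrite lte_fin expr2 mulrA ltr_pM2r// => /ltW cy.
  by rewrite ler_pdivlMr// mulrC.
by rewrite EFin_expe lee_sqr.
Qed.
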